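(* Let $S$ be a finite set, $d\ge 1$, and let $X\subset S^{\mathbb Z^d}$ be an irreducible $\mathbb Z^d$-topological Markov shift such that the tail relation $\mathfrak T(X)$ is topologically transitive on $X$. Let $\mathbb G$ be a countable Abelian group and $G:S\to\mathbb G$. If $p$ is a Borel probability measure on $X$ which is global, $\mathfrak T(X)$-nonsingular, and $\mathfrak T(X)[\Psi_G]$-invariant and $\mathfrak T(X)[\Psi_G]$-ergodic, then there is a group homomorphism $H:\mathbb G\to\mathbb R$ such that $p$ is $H\circ G$-conformal, i.e. for every Borel bijection $\Phi:B\to C$ between Borel sets $B,C\subset X$ with $(x,\Phi(x))\in\mathfrak T(X)$ for all $x\in B$, one has $\frac{d\,p\circ\Phi}{dp}(x)=e^{H(\Psi_G(x,\Phi(x)))}$ for $p$-a.e. $x\in B$.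
   Context: Notation: for $n\in\mathbb Z^d$, $\|n\|=\max_k|n_k|$ and $B(n,r)=\{k\in\mathbb Z^d:\|k-n\|\le r\}$. For $x\in S^{\mathbb Z^d}$ and $\Lambda\subset\mathbb Z^d$, $x_\Lambda\in S^\Lambda$ is the restriction. The shift is $(T_kx)_n=x_{n+k}$. A $\mathbb Z^d$-topological Markov shift (TMS) is a set of the form $X=\{x\in S^{\mathbb Z^d}:(x_k,(x_{k+j})_{j\in\partial B(0,1)})\in A\ \forall k\in\mathbb Z^d\}$ for some $A\subset S\times S^{\partial B(0,1)}$, where $\partial B(0,1)=B(0,1)\setminus\{0\}$. $X$ is irreducible if for all nonempty open $U,V\subset X$ there is $k\in\mathbb Z^d$ with $U\cap T_kV\ne\emptyset$. The tail relation is $\mathfrak T(X)=\{(x,y)\in X\times X:\exists F\subset\mathbb Z^d\text{ finite},\ x_{F^c}=y_{F^c}\}$. For $G:S\to\mathbb G$ and $(x,y)\in\mathfrak T(X)$, $\Psi_G(x,y)=\sum_{j\in\mathbb Z^d}(G(y_j)-G(x_j))$ (a finite sum), and $\mathfrak T(X)[\Psi_G]=\{(x,y)\in\mathfrak T(X):\Psi_G(x,y)=0\}$. For a countable Borel equivalence relation $\mathcal R$ on $X$: $\mathcal R$ is topologically transitive if $(U\times V)\cap\mathcal R\neq\emptyset$ for all nonempty open $U,V\subset X$; $p$ is $\mathcal R$-nonsingular if $p(A)=0$ implies $p(\mathcal R(A))=0$, where $\mathcal R(A)=\{y:\exists x\in A,(x,y)\in\mathcal R\}$; $p$ is $\mathcal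 R$-invariant if it is nonsingular and every Borel bijection $\Phi:B\to C$ with $(x,\Phi(x))\in\mathcal R$ preserves $p$ (i.e. $p\circ\Phi=p$ on $B$); $p$ is $\mathcal R$-ergodic if every Borel set $A$ with ($x\in A$, $(x,y)\in\mathcal R$ $\Rightarrow y\in A$) has $p(A)\in\{0,1\}$. $p$ is global if every nonempty open subset of $X$ has positive $p$-measure. *)

(* Defs.v *)
From HB Require Import structures.
From mathcomp Require Import all_boot all_order all_algebra.
From mathcomp Require Import all_classical all_reals all_analysis.
Set Implicit Arguments. Unset Strict Implicit. Unset Printing Implicit Defensive.
Import Order.TTheory GRing.Theory Num.Theory.
Local Open Scope classical_set_scope.
Local Open Scope ring_scope.

Definition Zd (d : nat) := 'rV[int]_d.

Definition supnorm d (n : Zd d) : nat := \max_(k < d) `|n ord0 k|%N.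

(** The alphabet S, with a distinguished point s0; the point is only used to
    equip the configuration space with the pointedType structure that
    MathComp-Analysis requires for measurable types. *)
Definition alph (S : finType) (s0 : S) : Type := S.
HB.instance Definition _ (S : finType) (s0 : S) := Choice.on (alph s0).
HB.instance Definition _ (S : finType) (s0 : S) := isPointed.Build (alph s0) s0.

Definition cfg d (S : finType) (s0 : S) := Zd d -> alph s0.

(** Open sets of the product topology on S^{Z^d} (S discrete): U is open iff
    every x in U has a cylinder neighbourhood {y : y_{B(0,r)} = x_{B(0,r)}}
    contained in U (the boxes B(0,r) are cofinal among finite windows). *)
Definition cfg_open d (S : finType) (s0 : S) : set (set (cfg d s0)) :=
  [set U | forall x, U x -> exists r : nat,
     forall y : cfg d s0, (forall j, (supnorm j <= r)%N -> y j = x j) -> U y].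

Definition cfgB d (S : finType) (s0 : S) := g_sigma_algebraType (@cfg_open d S s0).

Section Defs.
Context (d : nat) (S : finType) (s0 : S).
Local Notation Omega := (cfgB d s0).

Definition tms_open_in (X U : set Omega) : Prop :=
  exists V, cfg_open V /\ U = X `&` V.

Definition tms_shift (k : Zd d) (x : Omega) : Omega := fun n => x (n + k).

Definition tms_nbr := {j : Zd d | (supnorm j <= 1)%N && (j != 0)}.

Definition tms_is_TMS (X : set Omega) : Prop :=
  exists A : set (S * (tms_nbr -> S)),
    X = [set x | forall k : Zd d, A (x k, fun j : tms_nbr => x (k + sval j))].

Definition tms_irreducible (X : set Omega) : Prop :=
  forall U V, tms_open_in X U -> tms_open_in X V -> U !=set0 -> V !=set0 ->
    exists k : Zd d, (U `&` (tms_shift k @` V)) !=set0.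

Definition tms_tail (X : set Omega) (x y : Omega) : Prop :=
  X x /\ X y /\ exists F : set (Zd d), finite_set F /\ forall n, ~ F n -> x n = y n.

Definition tms_Psi (GG : zmodType) (G : S -> GG) (x y : Omega) : GG :=
  \sum_(j \in [set: Zd d]) (G (y j) - G (x j)).

Definition tms_tail_Psi (X : set Omega) (GG : zmodType) (G : S -> GG) (x y : Omega) : Prop :=
  tms_tail X x y /\ tms_Psi G x y = 0.

Definition tms_top_transitive (X : set Omega) (Rel : Omega -> Omega -> Prop) : Prop :=
  forall U V, tms_open_in X U -> tms_open_in X V -> U !=set0 -> V !=set0 ->
    exists x y, U x /\ V y /\ Rel x y.

Definition tms_saturation (Rel : Omega -> Omega -> Prop) (A : set Omega) : set Omega :=
  [set y | exists x, A x /\ Rel x y].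

(** Phi : B -> C is a Borel bijection between Borel sets B, C
    (Borel measurable, bijective, with Borel measurable inverse, i.e. Phi maps
    Borel subsets of B to Borel sets). *)
Definition tms_borel_bij (B C : set Omega) (Phi : Omega -> Omega) : Prop :=
  measurable B /\ measurable C /\
  (forall x, B x -> C (Phi x)) /\
  (forall x y, B x -> B y -> Phi x = Phi y -> x = y) /\
  (forall z, C z -> exists x, B x /\ Phi x = z) /\
  measurable_fun B Phi /\
  (forall A, measurable A -> A `<=` B -> measurable (Phi @` A)).

Context (R : realType).

Definition tms_global (p : probability Omega R) (X : set Omega) : Prop :=
  forall U, tms_open_in X U -> U !=set0 -> (0 < p U)%E.

Definition tms_nonsingular (p : probability Omega R) (X : set Omega)
  (Rel : Omega -> Omega -> Prop) : Prop :=
  forall A, measurable A -> A `<=` X -> p A = 0%E -> p (tms_saturation Rel A) = 0%E.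

Definition tms_invariant (p : probability Omega R) (X : set Omega)
  (Rel : Omega -> Omega -> Prop) : Prop :=
  tms_nonsingular p X Rel /\
  forall B C Phi, tms_borel_bij B C Phi -> B `<=` X -> C `<=` X ->
    (forall x, B x -> Rel x (Phi x)) ->
    forall A, measurable A -> A `<=` B -> p (Phi @` A) = p A.

Definition tms_ergodic (p : probability Omega R) (X : set Omega)
  (Rel : Omega -> Omega -> Prop) : Prop :=
  forall A, measurable A -> A `<=` X ->
    (forall x y, A x -> Rel x y -> A y) -> p A = 0%E \/ p A = 1%E.

(** p is f-tms_conformal: for every Borel bijection Phi : B -> C inside T(X),
    d(p o Phi)/dp (x) = exp (f(tms_Psi... )) i.e. (p o Phi)(A) = int_A e^{..} dp
    for every Borel A subset of B (definition of the Radon-Nikodym derivative). *)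
Definition tms_conformal (p : probability Omega R) (X : set Omega)
  (c : Omega -> Omega -> R) : Prop :=
  forall B C Phi, tms_borel_bij B C Phi -> B `<=` X -> C `<=` X ->
    (forall x, B x -> tms_tail X x (Phi x)) ->
    forall A, measurable A -> A `<=` B ->
      p (Phi @` A) = (\int[p]_(x in A) (expR (c x (Phi x)))%:E)%E.

End Defs.

(* Main.v *)
Require Import Defs.
From HB Require Import structures.
From mathcomp Require Import all_boot all_order all_algebra.
From mathcomp Require Import all_classical all_reals all_analysis.
From mathcomp Require Import measurable_realfun.
Import Order.TTheory GRing.Theory Num.Theory.
Local Open Scope classical_set_scope.
Local Open Scope ring_scope.
Set Implicit Arguments.
Unset Strict Implicit.
Unset Printing Implicit Defensive.

(* A holonomy of value a is a partial Borel isomorphism whose graph lies in the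
   equivalence relation and on which the cocycle Psi is constantly a.  If two
   holonomies f and h of the same value scaled p differently, a Hahn
   decomposition would give sets A and B of positive measure on whose subsets
   f scales p by at most q and h by at least some q' > q.  Ergodicity of the
   kernel of Psi provides a holonomy v of value 0, hence p-preserving, from a
   piece of A into B; on that piece f and h o v have the same value, so they
   differ by a holonomy of value 0 and send it to sets of equal measure, a
   contradiction.  Hence holonomies of value a scale p by a constant c(a).  The
   values carried by sets of positive measure form a subgroup on which ln c is
   additive, and ln c extends to the whole group because R is divisible; the
   other values live on null sets. *)

(** * Homomorphisms into divisible groups *)

Definition divisible (W : zmodType) :=
  forall (w : W) n, (0 < n)%N -> exists v, v *+ n = w.

Lemma divisible_numField (R : numFieldType) : divisible R.
Proof.
move=> w n n_gt0; exists (w / n%:R).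
by rewrite -[LHS]mulr_natr divfK// pnatr_eq0 -lt0n.
Qed.

Definition hom_graph (V W : zmodType) (f : set (V * W)) :=
  [/\ f (0, 0),
      forall a b v w, f (a, v) -> f (b, w) -> f (a - b, v - w)
    & forall w, f (0, w) -> w = 0].

Section hom_graph_theory.
Variables V W : zmodType.
Implicit Types (f h : set (V * W)) (a b : V) (v w : W).

Lemma hom_graphMz f a v (m : int) : hom_graph f ->
  f (a, v) -> f (a *~ m, v *~ m).
Proof.
move=> [f0 fB _] fav.
have fN b w : f (b, w) -> f (- b, - w).
  by rewrite -[- b]sub0r -[- w]sub0r; exact: fB.
have fMn n : f (a *+ n, v *+ n).
  elim: n => [//|n /fN IHn]; rewrite !mulrS.
  by rewrite -[a *+ n]opprK -[v *+ n]opprK; exact: fB.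
by case: m => n; [exact: fMn|exact: fN].
Qed.

Lemma hom_graph_fun f a v w : hom_graph f -> f (a, v) -> f (a, w) -> v = w.
Proof.
move=> [_ fB f_fun] fv fw; apply/eqP; rewrite -subr_eq0; apply/eqP/f_fun.
by rewrite -(subrr a); exact: fB fv fw.
Qed.

Lemma hom_graph_bigcup (I : Type) (D : set I) (F : I -> set (V * W)) :
  D !=set0 -> (forall i, D i -> hom_graph (F i)) ->
  (forall i j, D i -> D j -> F i `<=` F j \/ F j `<=` F i) ->
  hom_graph (\bigcup_(i in D) F i).
Proof.
move=> [i0 Di0] FP F_total; split=> [|a b v w [i Di Fiv] [j Dj Fjw]|w [i Di]].
- by exists i0 => //; case: (FP _ Di0).
- have [FiFj|FjFi] := F_total _ _ Di Dj.
  + by exists j => //; case: (FP _ Dj) => _ FB _; apply: FB => //; exact: FiFj.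
  + by exists i => //; case: (FP _ Di) => _ FB _; apply: FB => //; exact: FjFi.
- by case: (FP _ Di) => _ _; apply.
Qed.

Lemma hom_graph_least_multiple f a n w : hom_graph f -> (0 < n)%N ->
  f (a *+ n, w) ->
  (forall k u, (0 < k)%N -> f (a *+ k, u) -> (n <= k)%N) ->
  forall (m : int) u, f (a *~ m, u) ->
    exists q : int, m = q * n /\ u = w *~ q.
Proof.
move=> fP n_gt0 faw n_min m u fmu; have [_ fB f_fun] := fP.
pose q := (m %/ n)%Z; pose r := `|(m %% n)%Z|%N.
have mE : m = q * n + r.
  by rewrite /r gez0_abs ?modz_ge0 -?lt0n//; exact: divz_eq.
have fr : f (a *+ r, u - w *~ q).
  have -> : a *+ r = a *~ m - (a *+ n) *~ q.
    by rewrite mE mulrzDr mulrC mulrzA addrAC subrr add0r.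
  by apply: fB => //; exact: hom_graphMz.
have r0 : r = 0%N.
  apply/eqP; rewrite -leqn0 leqNgt; apply/negP => /n_min/(_ fr).
  by rewrite leqNgt -ltz_nat /r gez0_abs ?modz_ge0 -?lt0n// ltz_pmod.
exists q; split; first by rewrite mE r0 addr0.
by move: fr; rewrite r0 mulr0n => /f_fun/subr0_eq.
Qed.

Hypothesis divW : divisible W.

Lemma exists_hom_graph_value f a : hom_graph f ->
  exists v, forall (m : int) w, f (a *~ m, w) -> w = v *~ m.
Proof.
move=> fP; have [_ _ f_fun] := fP.
pose multiple n := (0 < n)%N && `[< exists w, f (a *+ n, w) >].
have [n_ex|no_n] := pselect (exists n, multiple n).
  case: (ex_minnP n_ex) => n /andP[n_gt0 /asboolP[w fnw]] n_min.
  have [v vn] := divW w n_gt0; exists v => m u fmu.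
  have [|q [-> ->]] := hom_graph_least_multiple fP n_gt0 fnw _ fmu.
    move=> k y k_gt0 fky; apply: n_min.
    by rewrite /multiple k_gt0; apply/asboolP; exists y.
  by rewrite -vn mulrC mulrzA.
exists 0 => m w fmw; have [m0|m_neq0] := eqVneq m 0.
  by move: fmw; rewrite m0 mulr0z => /f_fun ->.
case: no_n; exists `|m|%N; rewrite /multiple absz_gt0 m_neq0; apply/asboolP.
exists (w *~ sgz m); rewrite -[_ *+ _]/(a *~ `|m|%N) abszEsg mulrC mulrzA.
exact: hom_graphMz.
Qed.

Lemma hom_graph_adjoin f a : hom_graph f ->
  exists h, [/\ hom_graph h, f `<=` h & exists v, h (a, v)].
Proof.
move=> fP; have [f0 fB f_fun] := fP; have [v vP] := exists_hom_graph_value a fP.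
exists [set z | exists m : int, f (z.1 - a *~ m, z.2 - v *~ m)]; split.
- split=> [|b c u w [m fu] [k fw]|w [m /=]].
  + by exists 0; rewrite !mulr0z !subr0.
  + have subrACA (Z : zmodType) (x y z t : Z) :
        x - y - (z - t) = x - z - (y - t).
      by rewrite opprD addrACA -opprD.
    exists (m - k); rewrite /= !mulrzBr (subrACA V) (subrACA W).
    exact: fB fu fw.
  + rewrite sub0r -mulrNz => /vP/eqP.
    by rewrite mulrNz subr_eq addNr => /eqP.
- by move=> [b w] fw; exists 0; rewrite !mulr0z !subr0.
- by exists v, 1; rewrite !mulr1z !subrr.
Qed.

(* Baer's theorem: a maximal graph is total. *)
Theorem hom_graph_extend f : hom_graph f ->
  exists H : V -> W, (forall a b, H (a + b) = H a + H b) /\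
    forall a w, f (a, w) -> H a = w.
Proof.
move=> fP.
have [F FP F_total|h [hP h_max]] :=
    @Zorn_bigcup _ [set h | hom_graph (f `|` h)].
  have [->|/set0P F_neq0] := eqVneq F set0.
    by rewrite /= bigcup_set0 setU0.
  rewrite /= -bigcupUr//; apply: hom_graph_bigcup => // h k Fh Fk.
  by have [hk|kh] := F_total _ _ Fh Fk; [left|right]; exact: setUS.
have h_total a : exists w, (f `|` h) (a, w).
  have [k [kP hk [v kav]]] := hom_graph_adjoin a hP.
  apply: contrapT => h_a; apply: (h_max k); last first.
    by rewrite /= setUidr//; exact: subset_trans hk.
  split; first exact: subset_trans hk.
  by move=> kh; apply: h_a; exists v; right; exact: kh.
have [H HP] := choice h_total; have [_ hB _] := hP.
exists H; split=> [a b|a w faw]; last first.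
  by apply: (hom_graph_fun hP (HP a)); left.
apply/eqP; rewrite -subr_eq; apply/eqP; apply: (hom_graph_fun hP _ (HP a)).
by have := hB _ _ _ _ (HP (a + b)) (HP b); rewrite addrK.
Qed.

End hom_graph_theory.

(** * Measures and measurable embeddings *)

Lemma trivIset_image_inj (I T1 T2 : Type) (D : set I) (A : set T1)
    (F : I -> set T1) (f : T1 -> T2) :
  set_inj A f -> (forall i, D i -> F i `<=` A) -> trivIset D F ->
  trivIset D (fun i => f @` F i).
Proof.
move=> f_inj FA F_triv i j Di Dj [_ [[x Fix <-] [y Fjy fyx]]].
apply: F_triv => //; exists x; split=> //.
by rewrite -(f_inj _ _ _ _ fyx) ?inE; [|exact: FA Fjy|exact: FA Fix].
Qed.

Section measure_comparison.
Context (d : measure_display) (T : measurableType d) (R : realType).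
Local Open Scope ereal_scope.

Lemma exists_subset_measure_le (mu nu : {finite_measure set T -> \bar R})
    (A : set T) : measurable A -> mu A < nu A ->
  exists B, [/\ measurable B, B `<=` A, 0 < nu B &
    forall C, measurable C -> C `<=` B -> mu C <= nu C].
Proof.
move=> mA mu_lt_nu.
pose diff : {charge set T -> \bar R} :=
  cadd (charge_of_finite_measure mu) (copp (charge_of_finite_measure nu)).
have [B [BA [mB B_neg] diffB]] := hahn_decomposition_lemma diff mA.
have nu_fin C : measurable C -> nu C \is a fin_num by exact: fin_num_measure.
exists B; split=> // [|C mC CB]; last by rewrite -sube_le0; exact: B_neg.
apply: (le_lt_trans (measure_ge0 mu B)).
rewrite -sube_lt0 ?nu_fin ?orbT//; apply: (le_lt_trans diffB).
by rewrite [ltLHS]/(mu A - nu A) sube_lt0 ?nu_fin ?orbT.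
Qed.

Lemma exists_measure_setI_gt0 (mu : {measure set T -> \bar R}) (I : countType)
    (A : set T) (F : I -> set T) : measurable A ->
  (forall i, measurable (F i)) -> A `<=` \bigcup_i F i -> 0 < mu A ->
  exists i, 0 < mu (A `&` F i).
Proof.
move=> mA mF AF; apply: contraPP => /forallNP AF_null.
apply/negP; rewrite -leNgt measure_le0; apply/eqP/measure_negligible => //.
pose F_ n := if @unpickle I n is Some i then A `&` F i else set0.
apply: (@negligibleS _ _ _ _ (\bigcup_n F_ n)).
  move=> x Ax; have [i _ Fix] := AF _ Ax.
  by exists (pickle i) => //; rewrite /F_ pickleK.
apply: negligible_bigcup => n; rewrite /F_.
case: unpickle => [i|]; last exact: negligible_set0.
apply/negligibleP; first exact: measurableI.
by apply/eqP; rewrite -measure_le0 leNgt; apply/negP/AF_null.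
Qed.

End measure_comparison.

Definition measurable_embedding (d1 d2 : measure_display)
    (T1 : measurableType d1) (T2 : measurableType d2)
    (A : set T1) (f : T1 -> T2) : Prop :=
  [/\ measurable A, set_inj A f, measurable_fun A f
    & forall B, measurable B -> B `<=` A -> measurable (f @` B)].

Lemma measurable_embedding_cancel (d1 d2 : measure_display)
    (T1 : measurableType d1) (T2 : measurableType d2) (A : set T1)
    (f : T1 -> T2) (h : T2 -> T1) :
  measurable A -> measurable (f @` A) ->
  measurable_fun A f -> measurable_fun (f @` A) h ->
  {in A, cancel f h} -> measurable_embedding A f.
Proof.
move=> mA mfA mf mh fK; split=> // [|B mB BA]; first exact: can_in_inj fK.
rewrite (_ : f @` B = f @` A `&` h @^-1` B); first exact: mh.
apply/seteqP; split=> [_ [x Bx <-]|_ [[x Ax <-]]].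
  have Ax := BA _ Bx.
  by split; [exists x|rewrite /preimage /= fK// inE].
by rewrite /preimage /= fK ?inE// => Bx; exists x.
Qed.

Section measurable_embedding_theory.
Context (d1 d2 d3 : measure_display) (T1 : measurableType d1)
  (T2 : measurableType d2) (T3 : measurableType d3).
Implicit Types (A B : set T1) (f : T1 -> T2) (g : T2 -> T3).

Lemma sub_measurable_embedding A B f : measurable_embedding A f ->
  measurable B -> B `<=` A -> measurable_embedding B f.
Proof.
move=> [mA f_inj mf f_img] mB BA; split=> //.
- by apply: sub_in2 f_inj => x; rewrite !inE; exact: BA.
- exact: measurable_funS mf.
- by move=> C mC CB; apply: f_img => //; exact: subset_trans BA.
Qed.

Lemma comp_measurable_embedding A f g : measurable_embedding A f ->
  measurable_embedding (f @` A) g -> measurable_embedding A (g \o f).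
Proof.
move=> [mA f_inj mf f_img] [mfA g_inj mg g_img]; split=> //.
- move=> x y Ax Ay /g_inj fxy; apply: f_inj => //; apply: fxy.
  + by rewrite inE; exists x => //; rewrite -in_setE.
  + by rewrite inE; exists y => //; rewrite -in_setE.
- exact: measurable_comp mg mf.
- move=> B mB BA; rewrite -image_comp.
  by apply: g_img; [exact: f_img|exact: image_subset].
Qed.

Lemma measurable_embedding_pinv A f : measurable_embedding A f ->
  measurable_embedding (f @` A) (pinv A f).
Proof.
move=> [mA f_inj mf f_img]; have mfA : measurable (f @` A) by exact: f_img.
have pinvfA := injpinv_image (fun=> point) f_inj.
apply: (@measurable_embedding_cancel _ _ _ _ _ _ f); rewrite ?pinvfA//.
- move=> _ B mB.
  rewrite (_ : _ `&` _ = f @` (A `&` B)).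
    by apply: f_img; [exact: measurableI|exact: subIsetl].
  apply/seteqP; split=> [_ [[x Ax <-]]|_ [x [Ax Bx] <-]].
    by rewrite /preimage /= pinvKV ?inE// => Bx; exists x.
  by split; [exists x|rewrite /preimage /= pinvKV ?inE].
- exact: pinvK.
Qed.

End measurable_embedding_theory.

Lemma image_setI_preimage (T1 T2 : Type) (A : set T1) (C : set T2)
    (f : T1 -> T2) :
  f @` (A `&` f @^-1` C) = f @` A `&` C.
Proof.
apply/seteqP; split=> [_ [x [Ax Cfx] <-]|_ [[x Ax <-] Cfx]]; last by exists x.
by split=> //; exists x.
Qed.

Lemma exists_image_measure (d1 d2 : measure_display) (T1 : measurableType d1)
    (T2 : measurableType d2) (R : realType)
    (mu : {finite_measure set T2 -> \bar R}) (A : set T1) (f : T1 -> T2) :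
  measurable_embedding A f ->
  exists nu : {finite_measure set T1 -> \bar R},
    forall B, B `<=` A -> nu B = mu (f @` B).
Proof.
move=> [mA f_inj mf f_img]; pose nu B := mu (f @` (A `&` B)).
have mfI B : measurable B -> measurable (f @` (A `&` B)).
  by move=> mB; apply: f_img; [exact: measurableI|exact: subIsetl].
have nu0 : nu set0 = 0%E by rewrite /nu setI0 image_set0 measure0.
have nu_ge0 B : (0 <= nu B)%E by exact: measure_ge0.
have nu_sigma_additive : semi_sigma_additive nu.
  move=> F mF F_triv mUF; rewrite /nu setI_bigcupr image_bigcup.
  apply: measure_semi_sigma_additive => [n||].
  - exact: mfI.
  - apply: (trivIset_image_inj f_inj) => [i _|]; first exact: subIsetl.
    exact: trivIset_setIl.
  - by rewrite -image_bigcup -setI_bigcupr; exact: mfI.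
have nu_fin : fin_num_fun nu by move=> B mB; exact/fin_num_measure/mfI.
pose nu_isMeasure := isMeasure.Build _ _ _ nu nu0 nu_ge0 nu_sigma_additive.
pose nu_measure : {measure set T1 -> \bar R} := HB.pack nu nu_isMeasure.
pose nu_isFinite := Measure_isFinite.Build _ _ _ nu_measure nu_fin.
pose nu_finite : {finite_measure set T1 -> \bar R} :=
  HB.pack nu nu_isMeasure nu_isFinite.
by exists nu_finite => B BA; rewrite -[LHS]/(nu B) /nu setIidr.
Qed.

Definition countably_separated (d : measure_display) (T : measurableType d) :=
  exists (I : countType) (U : I -> set T), (forall i, measurable (U i)) /\
    forall x y, (forall i, U i x <-> U i y) -> x = y.

Lemma measurable_eq_set (d1 d2 : measure_display) (T1 : measurableType d1)
    (T2 : measurableType d2) (A : set T1) (f g : T1 -> T2) :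
  countably_separated T2 -> measurable A ->
  measurable_fun A f -> measurable_fun A g ->
  measurable (A `&` [set x | f x = g x]).
Proof.
move=> [I [U [mU U_sep]]] mA mf mg.
pose fU i := A `&` f @^-1` U i; pose gU i := A `&` g @^-1` U i.
rewrite (_ : _ `&` _ = A `\` \bigcup_i ((fU i `\` gU i) `|` (gU i `\` fU i))).
  apply: measurableD => //; apply: countable_bigcupT_measurable => // i.
  by apply: measurableU; apply: measurableD; do ?[exact: mf|exact: mg].
apply/seteqP; split=> [x [Ax /= fgx]|x [Ax fgx]]; split=> //.
  by move=> [i _]; rewrite /fU /gU /preimage /= fgx => -[[]|[]].
apply: U_sep => i; split=> Ux; apply: contrapT => nUx; apply: fgx;
  exists i => //.
- by left; split=> // -[].
- by right; split=> // -[].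
Qed.

(** * Holonomies of a cocycle *)

Section holonomy.
Context (d : measure_display) (T : measurableType d) (GG : zmodType).
Variables (E : T -> T -> Prop) (Psi : T -> T -> GG).
Implicit Types (A B : set T) (f h : T -> T) (a b : GG).

Definition holonomy a A f := [/\ measurable_embedding A f,
  forall x, A x -> E x (f x) & forall x, A x -> Psi x (f x) = a].

Lemma sub_holonomy a A B f :
  holonomy a A f -> measurable B -> B `<=` A -> holonomy a B f.
Proof.
move=> [fP fE fPsi] mB BA; split=> [|x /BA/fE|x /BA/fPsi] //.
exact: sub_measurable_embedding fP mB BA.
Qed.

Lemma measurable_holonomy a A f : holonomy a A f -> measurable A.
Proof. by move=> [[]]. Qed.

Lemma measurable_holonomy_image a A f : holonomy a A f -> measurable (f @` A).
Proof. by move=> [[mA _ _ f_img] _ _]; exact: f_img. Qed.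

Hypothesis E_trans : forall x y z, E x y -> E y z -> E x z.
Hypothesis Psi_cocycle :
  forall x y z, E x y -> E y z -> Psi x z = Psi x y + Psi y z.

Lemma comp_holonomy a b A B f h : holonomy a A f -> holonomy b B h ->
  f @` A `<=` B -> holonomy (a + b) A (h \o f).
Proof.
move=> fP hP fAB; have mfA := measurable_holonomy_image fP.
have [h_emb hE hPsi] := sub_holonomy hP mfA fAB; have [f_emb fE fPsi] := fP.
have fA x : A x -> (f @` A) (f x) by move=> Ax; exists x.
split=> [|x Ax|x Ax]; first exact: comp_measurable_embedding.
- by apply: E_trans (fE _ Ax) (hE _ _); exact: fA.
- by rewrite (Psi_cocycle (fE _ Ax) (hE _ (fA _ Ax))) fPsi// hPsi//; exact: fA.
Qed.

Lemma cocycle_refl x : E x x -> Psi x x = 0.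
Proof.
by move=> Exx; apply: (@addrI _ (Psi x x)); rewrite addr0 -Psi_cocycle.
Qed.

Lemma id_holonomy A : measurable A -> (forall x, A x -> E x x) ->
  holonomy 0 A id.
Proof.
move=> mA AE; split=> [|//|x Ax]; last exact: cocycle_refl (AE _ Ax).
by split=> // B mB _; rewrite image_id.
Qed.

Hypothesis E_sym : forall x y, E x y -> E y x.

Lemma cocycle_sym x y : E x y -> Psi y x = - Psi x y.
Proof.
move=> Exy; have Eyx := E_sym Exy; apply/eqP; rewrite -addr_eq0.
by rewrite -Psi_cocycle// cocycle_refl//; exact: E_trans Exy.
Qed.

Lemma pinv_holonomy a A f :
  holonomy a A f -> holonomy (- a) (f @` A) (pinv A f).
Proof.
move=> [f_emb fE fPsi]; have [_ f_inj _ _] := f_emb.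
have fK x : A x -> pinv A f (f x) = x by move=> Ax; rewrite pinvKV ?inE.
split=> [|_ [x Ax <-]|_ [x Ax <-]]; first exact: measurable_embedding_pinv.
- by rewrite fK//; exact/E_sym/fE.
- by rewrite fK// cocycle_sym ?fPsi//; exact: fE.
Qed.

End holonomy.

Section countable_relation.
Context (d : measure_display) (T : measurableType d) (GG : countZmodType).
Variables (E : T -> T -> Prop) (Psi : T -> T -> GG).
Local Notation holonomy := (holonomy E Psi).
Implicit Types (A B : set T) (f : T -> T) (a : GG).

Context (I : countType) (dom : GG -> I -> set T) (phi : I -> T -> T).
Hypothesis phi_holonomy : forall a i, holonomy a (dom a i) (phi i).
Hypothesis phi_cover :
  forall x y, E x y -> exists2 i, dom (Psi x y) i x & phi i x = y.

Lemma measurable_dom a i : measurable (dom a i).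
Proof. by case: (phi_holonomy a i) => -[]. Qed.

Lemma phi_dom_holonomy a i A :
  measurable A -> holonomy a (A `&` dom a i) (phi i).
Proof.
move=> mA; apply: (sub_holonomy (phi_holonomy a i)); last exact: subIsetr.
exact: measurableI (measurable_dom a i).
Qed.

Lemma saturationE A (P : set GG) :
  [set y | exists x, [/\ A x, E x y & P (Psi x y)]] =
  \bigcup_(k in [set k : GG * I | P k.1]) phi k.2 @` (A `&` dom k.1 k.2).
Proof.
apply/seteqP; split=> [y [x [Ax Exy Pxy]]|_ [[a i] /= Pa [x [Ax Dx] <-]]].
  have [i Dx <-] := phi_cover Exy.
  by exists (Psi x y, i) => //; exists x.
have [_ phiE phiPsi] := phi_holonomy a i.
by exists x; split; rewrite ?phiPsi//; exact: phiE.
Qed.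

Lemma measurable_saturation A (P : set GG) : measurable A ->
  measurable [set y | exists x, [/\ A x, E x y & P (Psi x y)]].
Proof.
move=> mA; rewrite saturationE bigcup_mkcond.
apply: countable_bigcupT_measurable => // -[a i]; case: ifPn => // _.
exact: measurable_holonomy_image (phi_dom_holonomy a i mA).
Qed.

Hypothesis sepT : countably_separated T.

Lemma level_holonomy a A f : measurable_embedding A f ->
  (forall x, A x -> E x (f x)) ->
  holonomy a (A `&` [set x | Psi x (f x) = a]) f.
Proof.
move=> f_emb fE; have [mA _ mf _] := f_emb.
split=> [|x [/fE]|x []] //.
apply: (sub_measurable_embedding f_emb) => [|x []//].
have -> : A `&` [set x | Psi x (f x) = a] =
    \bigcup_i (A `&` dom a i `&` [set x | phi i x = f x]).
  apply/seteqP; split=> [x [Ax xa]|x [i _ [[Ax Dx] /= fx]]].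
    have [i Dx fx] := phi_cover (fE _ Ax); rewrite xa in Dx.
    by exists i.
  by split=> //=; rewrite -fx; have [_ _] := phi_holonomy a i; exact.
apply: countable_bigcupT_measurable => // i.
have mAi := measurable_holonomy (phi_dom_holonomy a i mA).
apply: measurable_eq_set => //; last exact: measurable_funS mf.
by case: (phi_dom_holonomy a i mA) => -[].
Qed.

Lemma pickle_level_holonomy A f n : measurable_embedding A f ->
  (forall x, A x -> E x (f x)) ->
  exists a, holonomy a (A `&` [set x | pickle (Psi x (f x)) = n]) f.
Proof.
move=> f_emb fE.
have [[a <-]|n_pickle] := pselect (exists a : GG, pickle a = n).
  exists a; rewrite (_ : _ `&` _ = A `&` [set x | Psi x (f x) = a]).
    exact: level_holonomy.
  congr (_ `&` _); apply/seteqP; split=> x /=; last by move->.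
  exact: (pcan_inj pickleK).
exists 0; rewrite (_ : _ `&` _ = set0).
  exact: (sub_holonomy (level_holonomy 0 f_emb fE)).
by apply/seteqP; split=> // x [_ /= xn]; apply: n_pickle; exists (Psi x (f x)).
Qed.

Lemma image_integral_density (R : realType)
    (mu : {measure set T -> \bar R}) (c : GG -> R) A f :
  (forall a, 0 <= c a) ->
  (forall a B h, holonomy a B h -> mu (h @` B) = ((c a)%:E * mu B)%E) ->
  measurable_embedding A f -> (forall x, A x -> E x (f x)) ->
  mu (f @` A) = (\int[mu]_(x in A) (c (Psi x (f x)))%:E)%E.
Proof.
move=> c_ge0 cP f_emb fE; have [mA f_inj _ f_img] := f_emb.
pose level n := A `&` [set x | pickle (Psi x (f x)) = n].
have level_triv : trivIset setT level by exact: trivIset_preimage1_in.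
have levelP n : exists a, holonomy a (level n) f.
  exact: pickle_level_holonomy.
have m_level n : measurable (level n).
  by have [a /measurable_holonomy] := levelP n.
have level_cover : A = \bigcup_n level n.
  apply/seteqP; split=> [x Ax|x [n _ []]//].
  by exists (pickle (Psi x (f x))).
have level_cst n : exists a, holonomy a (level n) f /\
    {in level n, cst (c a)%:E =1 (fun x => (c (Psi x (f x)))%:E)}.
  have [a fP] := levelP n; exists a; split=> // x.
  by rewrite inE; case: fP => _ _ fPsi /fPsi ->.
have integral_level n :
    (\int[mu]_(x in level n) (c (Psi x (f x)))%:E)%E = mu (f @` level n).
  have [a [fP cE]] := level_cst n.
  rewrite -(eq_integral _ _ cE) integral_cst//; exact/esym/cP.
rewrite level_cover image_bigcup measure_semi_bigcup; last 3 first.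
- by move=> n; have [a /measurable_holonomy_image] := levelP n.
- by apply: (trivIset_image_inj f_inj) => // n _; exact: subIsetl.
- by rewrite -image_bigcup -level_cover; exact: f_img.
rewrite ge0_integral_bigcup//.
- by apply: eq_eseriesr => n _; rewrite integral_level.
- apply/measurable_fun_bigcup => // n; have [a [_ cE]] := level_cst n.
  by apply: (eq_measurable_fun (cst (c a)%:E)) => //; exact: cE.
- by move=> x _; rewrite lee_fin.
Qed.

End countable_relation.

Section ergodic_kernel.
Context (d : measure_display) (T : measurableType d) (R : realType)
  (GG : countZmodType) (p : probability T R).
Variables (X : set T) (E : T -> T -> Prop) (Psi : T -> T -> GG).
Local Notation holonomy := (holonomy E Psi).
Implicit Types (A B C : set T) (f h : T -> T) (a b : GG).

Hypothesis E_sub : forall x y, E x y -> X x.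
Hypothesis E_refl : forall x, X x -> E x x.
Hypothesis E_sym : forall x y, E x y -> E y x.
Hypothesis E_trans : forall x y z, E x y -> E y z -> E x z.
Hypothesis Psi_cocycle :
  forall x y z, E x y -> E y z -> Psi x z = Psi x y + Psi y z.

Context (I : countType) (dom : GG -> I -> set T) (phi : I -> T -> T).
Hypothesis phi_holonomy : forall a i, holonomy a (dom a i) (phi i).
Hypothesis phi_cover :
  forall x y, E x y -> exists2 i, dom (Psi x y) i x & phi i x = y.

Hypothesis p_nonsingular : forall A, measurable A -> A `<=` X -> p A = 0%E ->
  p [set y | exists x, A x /\ E x y] = 0%E.
Hypothesis p_invariant : forall A f, holonomy 0 A f -> p (f @` A) = p A.
Hypothesis p_ergodic : forall A, measurable A -> A `<=` X ->
  (forall x y, A x -> E x y -> Psi x y = 0 -> A y) -> p A = 0%E \/ p A = 1%E.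

Lemma holonomy_dom_sub a A f : holonomy a A f -> A `<=` X.
Proof. by move=> [_ fE _] x /fE/E_sub. Qed.

Lemma holonomy_image_null a A f :
  holonomy a A f -> p A = 0%E -> p (f @` A) = 0%E.
Proof.
move=> fP pA; have [[mA _ _ _] fE _] := fP.
have satE : [set y | exists x, A x /\ E x y] =
    [set y | exists x, [/\ A x, E x y & [set: GG] (Psi x y)]].
  by apply/seteqP; split=> y [x]; [move=> [? ?]|move=> [? ? _]]; exists x.
apply: (@subset_measure0 _ _ _ _ _ [set y | exists x, A x /\ E x y]).
- exact: measurable_holonomy_image fP.
- by rewrite satE; exact: (measurable_saturation phi_holonomy phi_cover).
- by move=> _ [x Ax <-]; exists x; split=> //; exact: fE.
- exact: p_nonsingular (holonomy_dom_sub fP) pA.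
Qed.

Lemma holonomy_image_gt0 a A f : holonomy a A f ->
  (0 < p (f @` A))%E = (0 < p A)%E.
Proof.
move=> fP; rewrite !lt0e !measure_ge0 !andbT; congr (~~ _).
have [[_ f_inj _ _] _ _] := fP.
apply/eqP/eqP; last exact: holonomy_image_null fP.
move/(holonomy_image_null (pinv_holonomy E_trans Psi_cocycle E_sym fP)).
by rewrite injpinv_image.
Qed.

Lemma holonomy_image_eq a A f h : holonomy a A f -> holonomy a A h ->
  p (f @` A) = p (h @` A).
Proof.
move=> fP hP; have [[_ h_inj _ _] _ _] := hP.
have pinv_hA := injpinv_image (fun=> point) h_inj.
have fhP : holonomy 0 (h @` A) (f \o pinv A h).
  rewrite -(addNr a); apply: (comp_holonomy E_trans Psi_cocycle _ fP).
    exact: (pinv_holonomy E_trans Psi_cocycle E_sym hP).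
  by rewrite pinv_hA.
by rewrite -(p_invariant fhP) -image_comp pinv_hA.
Qed.

Definition kernel_saturation A :=
  [set y | exists x, [/\ A x, E x y & Psi x y = 0]].

Lemma kernel_saturationE A :
  kernel_saturation A = \bigcup_i phi i @` (A `&` dom 0 i).
Proof.
rewrite [LHS](saturationE phi_holonomy phi_cover A [set 0]); apply/seteqP.
split=> [y [[a i] /= -> yi]|y [i _ yi]]; first by exists i.
by exists (0, i).
Qed.

Lemma measurable_kernel_saturation A :
  measurable A -> measurable (kernel_saturation A).
Proof. exact: (measurable_saturation phi_holonomy phi_cover [set 0]). Qed.

Lemma kernel_saturation_full A : measurable A -> A `<=` X -> (0 < p A)%E ->
  p (kernel_saturation A) = 1%E.
Proof.
move=> mA AX pA; have mY := measurable_kernel_saturation mA.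
have AY : A `<=` kernel_saturation A.
  move=> x Ax; have Exx := E_refl (AX _ Ax).
  by exists x; split=> //; exact: (cocycle_refl Psi_cocycle).
have [|y z [x [Ax Exy Pxy]] Eyz Pyz|pY0|//] := p_ergodic mY.
- by move=> y [x [_ /E_sym/E_sub]].
- exists x; split=> //; first exact: E_trans Eyz.
  by rewrite (Psi_cocycle Exy Eyz) Pxy Pyz addr0.
- by move: pA; rewrite (subset_measure0 mA mY AY pY0) ltxx.
Qed.

Lemma exists_kernel_holonomy A B : measurable A -> measurable B -> A `<=` X ->
  (0 < p A)%E -> (0 < p B)%E ->
  exists C f, [/\ holonomy 0 C f, C `<=` A, f @` C `<=` B & (0 < p C)%E].
Proof.
move=> mA mB AX pA pB.
have mY := measurable_kernel_saturation mA.
set Y := kernel_saturation A in mY.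
have pBY : (0 < p (B `&` Y))%E.
  suff pBDY : p (B `\` Y) = 0%E.
    by rewrite (measureDI p mB mY) [X in (X + _)%E]pBDY add0e in pB.
  apply: (@subset_measure0 _ _ _ _ _ (~` Y)) => //; first exact: measurableD.
    exact: measurableC.
  by rewrite [LHS]probability_setC// kernel_saturation_full// subee.
have [|i||i pBYi] := @exists_measure_setI_gt0 _ _ _ p I (B `&` Y)
  (fun i => phi i @` (A `&` dom 0 i)) _ _ _ pBY.
- exact: measurableI.
- exact: measurable_holonomy_image (phi_dom_holonomy phi_holonomy 0 i mA).
- by rewrite -kernel_saturationE; exact: subIsetr.
have phiA := phi_dom_holonomy phi_holonomy 0 i mA.
pose C := A `&` dom 0 i `&` phi i @^-1` (B `&` Y).
have phiC : holonomy 0 C (phi i).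
  apply: (sub_holonomy phiA) => [|x []//].
  by case: phiA => -[mAi _ mphi _] _ _; apply: mphi => //; exact: measurableI.
exists C, (phi i); split=> //.
- by move=> x [[]].
- by rewrite image_setI_preimage => y [_ []].
- by rewrite -(holonomy_image_gt0 phiC) image_setI_preimage setIC.
Qed.

Lemma exists_sub_holonomy_le a A f (q : R) : holonomy a A f -> 0 <= q ->
  (p (f @` A) < q%:E * p A)%E ->
  exists B, [/\ holonomy a B f, B `<=` A, (0 < p B)%E &
    forall C, measurable C -> C `<=` B -> (p (f @` C) <= q%:E * p C)%E].
Proof.
move=> fP q_ge0; have [f_emb _ _] := fP.
have [nu nuE] := exists_image_measure p f_emb.
rewrite -nuE// => /(@exists_subset_measure_le _ _ _ nu
  (mscale (NngNum q_ge0) p) _ (measurable_holonomy fP))[B [mB BA qB ltB]].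
exists B; split=> // [||C mC CB].
- exact: sub_holonomy fP mB BA.
- rewrite lt0e measure_ge0 andbT; apply/eqP => pB.
  by move: qB; rewrite /= /mscale/= pB mule0 ltxx.
- by rewrite -nuE; [exact: ltB|exact: subset_trans BA].
Qed.

Lemma exists_sub_holonomy_ge a A f (q : R) : holonomy a A f -> 0 <= q ->
  (q%:E * p A < p (f @` A))%E ->
  exists B, [/\ holonomy a B f, B `<=` A, (0 < p B)%E &
    forall C, measurable C -> C `<=` B -> (q%:E * p C <= p (f @` C))%E].
Proof.
move=> fP q_ge0; have [f_emb _ _] := fP.
have [nu nuE] := exists_image_measure p f_emb.
rewrite -nuE// => /(@exists_subset_measure_le _ _ _
  (mscale (NngNum q_ge0) p) nu _ (measurable_holonomy fP))[B [mB BA qB ltB]].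
have fB := sub_holonomy fP mB BA.
exists B; split=> // [|C mC CB].
- by rewrite -(holonomy_image_gt0 fB) -nuE.
- by rewrite -nuE; [exact: ltB|exact: subset_trans BA].
Qed.

Lemma holonomy_image_scale_le a A B f h (q q' : R) :
  holonomy a A f -> holonomy a B h -> 0 <= q -> q < q' ->
  (p (f @` A) < q%:E * p A)%E -> (p (h @` B) <= q'%:E * p B)%E.
Proof.
move=> fP hP q_ge0 qq' fA; rewrite leNgt; apply/negP => hB.
have [A' [fA' A'A pA' leA']] := exists_sub_holonomy_le fP q_ge0 fA.
have [B' [hB' B'B pB' geB']] :=
  exists_sub_holonomy_ge hP (le_trans q_ge0 (ltW qq')) hB.
have [C [v [vP CA' vCB' pC]]] := exists_kernel_holonomy
  (measurable_holonomy fA') (measurable_holonomy hB')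
  (holonomy_dom_sub fA') pA' pB'.
have mC := measurable_holonomy vP.
have hvC := comp_holonomy E_trans Psi_cocycle vP hB' vCB'; rewrite add0r in hvC.
have := geB' _ (measurable_holonomy_image vP) vCB'.
rewrite p_invariant// image_comp.
rewrite (holonomy_image_eq hvC (sub_holonomy fA' mC CA')) =>
  /le_trans/(_ (leA' _ mC CA')).
by rewrite lee_pmul2r ?fin_num_measure// lee_fin leNgt qq'.
Qed.

Definition image_density A f : R := fine (p (f @` A)) / fine (p A).

Lemma image_density_ge0 A f : 0 <= image_density A f.
Proof. by rewrite divr_ge0// fine_ge0. Qed.

Lemma image_densityE a A f : holonomy a A f -> (0 < p A)%E ->
  p (f @` A) = ((image_density A f)%:E * p A)%E.
Proof.
move=> fP pA; have p_fineE B : measurable B -> p B = (fine (p B))%:E.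
  by move=> mB; rewrite fineK// fin_num_measure.
rewrite [in RHS](p_fineE _ (measurable_holonomy fP)) -EFinM divfK.
  exact: p_fineE (measurable_holonomy_image fP).
by rewrite gt_eqF// -lte_fin -p_fineE//; exact: measurable_holonomy fP.
Qed.

Lemma image_density_unique a A B f h : holonomy a A f -> holonomy a B h ->
  (0 < p A)%E -> (0 < p B)%E -> image_density A f = image_density B h.
Proof.
wlog: A B f h / image_density A f <= image_density B h.
  move=> le_case fP hP pA pB.
  have [AB|/ltW BA] := leP (image_density A f) (image_density B h).
    exact: le_case.
  exact/esym/le_case.
rewrite le_eqVlt => /predU1P[//|/midf_lt[Aq qB]] fP hP pA pB.
have [qq' q'B] := midf_lt qB.
have := @holonomy_image_scale_le a A B f h _ _ fP hP _ qq'.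
rewrite (image_densityE fP pA) (image_densityE hP pB).
rewrite lte_pmul2r ?lee_pmul2r ?fin_num_measure//;
  do ?[exact: measurable_holonomy fP|exact: measurable_holonomy hP].
rewrite lte_fin lee_fin => /(_ (le_trans (image_density_ge0 A f) (ltW Aq)) Aq).
by rewrite leNgt q'B.
Qed.

Definition charged a := exists A f, holonomy a A f /\ (0 < p A)%E.

Lemma exists_holonomy_density a : exists2 c : R, 0 < c &
  forall A f, holonomy a A f -> p (f @` A) = (c%:E * p A)%E.
Proof.
have image0 A f : holonomy a A f -> p A = 0%E -> forall c : R,
    p (f @` A) = (c%:E * p A)%E.
  by move=> fP pA c; rewrite (holonomy_image_null fP pA) pA mule0.
have [[A [f [fP pA]]]|a_null] := pselect (charged a); last first.
  exists 1 => // A f fP; apply: image0 => //; apply: contrapT => /eqP pA.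
  by apply: a_null; exists A, f; split; rewrite // lt0e pA measure_ge0.
exists (image_density A f) => [|B h hP].
  have := pA; rewrite -(holonomy_image_gt0 fP) (image_densityE fP pA).
  by rewrite pmule_lgt0// lte_fin.
have [pB|pB] := eqVneq (p B) 0%E; first exact: image0.
have {}pB : (0 < p B)%E by rewrite lt0e pB measure_ge0.
by rewrite (image_density_unique fP hP pA pB); exact: image_densityE hP pB.
Qed.

Definition holonomy_density a : R := s2val (cid2 (exists_holonomy_density a)).

Lemma holonomy_density_gt0 a : 0 < holonomy_density a.
Proof. by rewrite /holonomy_density; case: cid2. Qed.

Lemma holonomy_image a A f : holonomy a A f ->
  p (f @` A) = ((holonomy_density a)%:E * p A)%E.
Proof. by rewrite /holonomy_density; case: cid2 => c ? cP; exact: cP. Qed.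

Lemma holonomy_densityE a A f (r : R) : holonomy a A f -> (0 < p A)%E ->
  p (f @` A) = (r%:E * p A)%E -> holonomy_density a = r.
Proof.
move=> fP pA; rewrite (holonomy_image fP) => /eqP.
rewrite -(fineK (fin_num_measure p _ (measurable_holonomy fP))) -!EFinM eqe.
move/eqP/mulIf; apply; rewrite gt_eqF// fine_gt0// pA ltey_eq.
by rewrite fin_num_measure//; exact: measurable_holonomy fP.
Qed.

Lemma charged_opp a : charged a -> charged (- a) /\
  holonomy_density (- a) = (holonomy_density a)^-1.
Proof.
move=> [A [f [fP pA]]]; have [[_ f_inj _ _] _ _] := fP.
have pinvP := pinv_holonomy E_trans Psi_cocycle E_sym fP.
have pfA : (0 < p (f @` A))%E by rewrite (holonomy_image_gt0 fP).
split; first by exists (f @` A), (pinv A f).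
apply: (holonomy_densityE pinvP pfA).
rewrite injpinv_image// (holonomy_image fP) muleA -EFinM mulVf ?mul1e//.
by rewrite gt_eqF// holonomy_density_gt0.
Qed.

Lemma charged_add a b : charged a -> charged b -> charged (a + b) /\
  holonomy_density (a + b) = holonomy_density a * holonomy_density b.
Proof.
move=> [A [f [fP pA]]] [B [h [hP pB]]].
have fA_X : f @` A `<=` X.
  by move=> _ [x Ax <-]; case: fP => _ /(_ _ Ax)/E_sym/E_sub.
have [|C [v [vP CfA vCB pC]]] := exists_kernel_holonomy
  (measurable_holonomy_image fP) (measurable_holonomy hP) fA_X _ pB.
  by rewrite (holonomy_image_gt0 fP).
pose D := A `&` f @^-1` C.
have fD : f @` D = C by rewrite image_setI_preimage setIidr.
have fDP : holonomy a D f.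
  apply: (sub_holonomy fP) => [|x []//].
  have [[mA _ mf _] _ _] := fP.
  by apply: mf => //; exact: measurable_holonomy vP.
have pD : (0 < p D)%E by rewrite -(holonomy_image_gt0 fDP) fD.
have vfP : holonomy a D (v \o f).
  rewrite -[a]addr0; apply: (comp_holonomy E_trans Psi_cocycle fDP vP).
  by rewrite fD.
have hvfP : holonomy (a + b) D (h \o (v \o f)).
  apply: (comp_holonomy E_trans Psi_cocycle vfP hP).
  by rewrite -image_comp fD.
split; first by exists D, (h \o (v \o f)).
apply: (holonomy_densityE hvfP pD).
rewrite -image_comp mulrC EFinM -muleA -(holonomy_image vfP).
apply: holonomy_image; apply: (sub_holonomy hP).
  exact: measurable_holonomy_image vfP.
by rewrite -image_comp fD.
Qed.

Hypothesis mX : measurable X.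
Hypothesis pX : p X = 1%E.

Lemma charged0 : charged 0 /\ holonomy_density 0 = 1.
Proof.
have idP := id_holonomy Psi_cocycle mX E_refl.
have pX_gt0 : (0 < p X)%E by rewrite pX.
split; first by exists X, id.
by apply: (holonomy_densityE idP pX_gt0); rewrite image_id mul1e.
Qed.

Lemma holonomy_density_hom : exists H : GG -> R,
  (forall a b, H (a + b) = H a + H b) /\
  forall a, charged a -> expR (H a) = holonomy_density a.
Proof.
pose c := holonomy_density; have c_pos a : c a \is Num.pos.
  by rewrite posrE; exact: holonomy_density_gt0.
have [charged_0 c0] := charged0.
pose f := [set z : GG * R | charged z.1 /\ z.2 = ln (c z.1)].
have fP : hom_graph f.
  split=> [|a b v w [/= a_ch ->] [/= b_ch ->]|w [_ /= ->]].
  - by split=> //=; rewrite /c c0 ln1.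
  - have [Nb_ch cNb] := charged_opp b_ch.
    have [ab_ch cab] := charged_add a_ch Nb_ch.
    by split=> //=; rewrite /c cab cNb lnM ?lnV ?rpredV.
  - by rewrite /c c0 ln1.
have [H [H_add H_graph]] := hom_graph_extend (@divisible_numField R) fP.
by exists H; split=> // a a_ch; rewrite (H_graph a (ln (c a)))// lnK.
Qed.

Theorem ergodic_kernel_conformal : countably_separated T ->
  exists H : GG -> R, (forall a b, H (a + b) = H a + H b) /\
    forall A f, measurable_embedding A f -> (forall x, A x -> E x (f x)) ->
      p (f @` A) = (\int[p]_(x in A) (expR (H (Psi x (f x))))%:E)%E.
Proof.
move=> sepT; have [H [H_add H_charged]] := holonomy_density_hom.
exists H; split=> // A f f_emb fE.
apply: (image_integral_density phi_holonomy phi_cover sepT (c := expR \o H))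
  => // [a|a B h hP /=]; first exact: expR_ge0.
have [pB|pB] := eqVneq (p B) 0%E.
  by rewrite (holonomy_image_null hP pB) pB mule0.
rewrite H_charged ?(holonomy_image hP)//.
by exists B, h; split; rewrite // lt0e pB measure_ge0.
Qed.

End ergodic_kernel.

(** * Configurations *)

Section configurations.
Context (d : nat) (S : finType) (s0 : S).
Local Notation Omega := (cfgB d s0).
Implicit Types (X : set Omega) (x y z : Omega) (t u : seq S) (N : nat).

Definition site (n : Zd d) : nat := pickle (n : 'rV[int]_d).

Definition overwrite t x : Omega := fun n => nth (x n) t (site n).

Lemma finite_site_lt N : finite_set [set n : Zd d | (site n < N)%N].
Proof.
apply: (@finite_preimage _ _ `I_N site); last exact: finite_II.
by move=> n m _ _; exact: (pcan_inj pickleK).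
Qed.

Lemma supnorm_site_bounded N :
  exists r, forall n : Zd d, (site n < N)%N -> (supnorm n <= r)%N.
Proof.
have /finite_seqP[A AE] := finite_site_lt N.
exists (\max_(n <- A) supnorm n)%N => n nN.
apply: (@leq_bigmax_seq 'rV[int]_d A xpredT (@supnorm d) n) => //.
by rewrite -[is_true _]/([set` A] n) -AE.
Qed.

Lemma supnormD (n m : Zd d) : (supnorm (n + m)%R <= supnorm n + supnorm m)%N.
Proof.
apply/bigmax_leqP => i _; rewrite mxE.
apply: (@leq_trans (`|n ord0 i| + `|m ord0 i|)%N).
  by rewrite -lez_nat PoszD !abszE ler_normD.
by apply: leq_add; [exact: (@leq_bigmax _ (fun i => `|n ord0 i|%N))
                   |exact: (@leq_bigmax _ (fun i => `|m ord0 i|%N))].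
Qed.

Lemma cfg_open_site (U : set (cfg d s0)) :
  (forall x, U x -> exists N, forall y : cfg d s0,
     (forall n, (site n < N)%N -> y n = x n) -> U y) -> cfg_open U.
Proof.
move=> UP x /UP[N NP]; have [r rP] := supnorm_site_bounded N.
by exists r => y yx; apply: NP => n /rP; exact: yx.
Qed.

Lemma cfg_open_measurable (U : set Omega) : cfg_open U -> measurable U.
Proof. exact: sub_sigma_algebra. Qed.

Lemma countably_separated_cfgB : countably_separated Omega.
Proof.
exists ('rV[int]_d * S)%type, (fun k => [set x : Omega | x k.1 = k.2]).
split=> [[n s]|x y xy].
  apply: cfg_open_measurable => x /= <-; exists (supnorm n) => y yx.
  exact: yx.
by apply/funext => n; apply/esym; apply/(xy (n, x n)).
Qed.

Lemma measurable_TMS X : tms_is_TMS X -> measurable X.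
Proof.
move=> [A ->]; rewrite -[X in measurable X]setCK; apply: measurableC.
apply: cfg_open_measurable => x /= /existsNP[k Ak].
exists (supnorm k + 1)%N => y yx yA; apply: Ak; have := yA k.
rewrite yx ?leq_addr//; congr (A (_, _)); apply/funext => -[j /= /andP[j1 _]].
by rewrite yx// (leq_trans (supnormD k j))// leq_add2l.
Qed.

Lemma measurable_overwrite t : measurable_fun [set: Omega] (overwrite t).
Proof.
apply: (@measurability _ _ Omega Omega setT (overwrite t) _ erefl).
move=> _ [U oU <-]; rewrite setTI; apply: cfg_open_measurable => x /= /oU[r rP].
by exists r => y yx; apply: rP => n nr; rewrite /overwrite yx.
Qed.

Lemma measurable_overwriteK t u :
  measurable ([set x | overwrite u (overwrite t x) = x] : set Omega).
Proof.
rewrite -[X in measurable X]setTI.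
apply: (measurable_eq_set countably_separated_cfgB) => //.
by apply: measurableT_comp; exact: measurable_overwrite.
Qed.

Lemma tms_tailE X x y : tms_tail X x y <->
  [/\ X x, X y & exists N, forall n, (N <= site n)%N -> x n = y n].
Proof.
split=> [[Xx [Xy [F [/finite_seqP[A ->] xy]]]]|[Xx Xy [N xy]]]; last first.
  split=> //; split=> //; exists [set n | (site n < N)%N].
  by split=> [|n /negP]; [exact: finite_site_lt|rewrite -leqNgt; exact: xy].
split=> //; exists (\max_(n <- A) site n).+1%N => n nN; apply: xy => /= nA.
by move: nN; rewrite ltnNge (@leq_bigmax_seq 'rV[int]_d A xpredT site n).
Qed.

Lemma tms_tail_refl X x : X x -> tms_tail X x x.
Proof. by move=> Xx; split=> //; split=> //; exists set0. Qed.

Lemma tms_tail_sym X x y : tms_tail X x y -> tms_tail X y x.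
Proof.
move=> [Xx [Xy [F [Ff xy]]]]; split=> //; split=> //.
by exists F; split=> // n /xy.
Qed.

Lemma tms_tail_trans X x y z :
  tms_tail X x y -> tms_tail X y z -> tms_tail X x z.
Proof.
move=> [Xx [_ [F [Ff xy]]]] [_ [Xz [H [Hf yz]]]]; split=> //; split=> //.
exists (F `|` H); split=> [|n /not_orP[nF nH]]; first by rewrite finite_setU.
by rewrite xy// yz.
Qed.

Lemma tms_tail_overwrite X t x :
  X x -> X (overwrite t x) -> tms_tail X x (overwrite t x).
Proof.
move=> Xx Xtx; apply/tms_tailE; split=> //.
by exists (size t) => n tn; rewrite /overwrite nth_default.
Qed.

Lemma exists_overwrite X x y : tms_tail X x y -> exists t, overwrite t x = y.
Proof.
move=> /tms_tailE[_ _ [N xy]].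
exists (mkseq (fun k => if unpickle k is Some n then y n else s0) N).
apply/funext => n; rewrite /overwrite.
have [nN|nN] := ltnP (site n) N; first by rewrite nth_mkseq// /site pickleK.
by rewrite nth_default ?size_mkseq// xy.
Qed.

Lemma tms_borel_bijP (B C : set Omega) (f : Omega -> Omega) :
  tms_borel_bij B C f <-> measurable_embedding B f /\ f @` B = C.
Proof.
split=> [[mB [mC [fBC [f_inj [f_surj [mf f_img]]]]]]|[[mB f_inj mf f_img] <-]].
  split; last first.
    by apply/seteqP; split=> [_ [x /fBC Cfx <-]|y /f_surj[x []]] //; exists x.
  by split=> // x y; rewrite !inE; exact: f_inj.
split=> //; split; first exact: f_img.
split; first by move=> x Bx; exists x.
split; first by move=> x y Bx By; apply: f_inj; rewrite inE.
by split=> // _ [x Bx <-]; exists x.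
Qed.

Section Psi.
Context (GG : zmodType) (G : S -> GG).
Local Notation Psi := (@tms_Psi d S s0 GG G).

Lemma tms_PsiE (F : set (Zd d)) x y : (forall n, ~ F n -> x n = y n) ->
  Psi x y = \sum_(n \in F) (G (y n) - G (x n)).
Proof.
move=> xy; rewrite /tms_Psi; symmetry; apply: fsbig_widen => // n [_ /= /xy ->].
by rewrite subrr.
Qed.

Lemma tms_Psi_cocycle X x y z : tms_tail X x y -> tms_tail X y z ->
  Psi x z = Psi x y + Psi y z.
Proof.
move=> [_ [_ [F [Ff xy]]]] [_ [_ [H [Hf yz]]]].
have xyFH n : ~ (F `|` H) n -> x n = y n by move=> /not_orP[/xy].
have yzFH n : ~ (F `|` H) n -> y n = z n by move=> /not_orP[_ /yz].
rewrite (tms_PsiE xyFH) (tms_PsiE yzFH) (@tms_PsiE (F `|` H)); last first.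
  by move=> n nFH; rewrite xyFH// yzFH.
rewrite -fsbig_split ?finite_setU//; apply: eq_fsbigr => n _ /=.
by rewrite [RHS]addrC addrA subrK.
Qed.

Lemma measurable_tms_Psi_overwrite t (g : GG) :
  measurable ([set x | Psi x (overwrite t x) = g] : set Omega).
Proof.
apply: cfg_open_measurable; apply: cfg_open_site => x /= <-.
exists (size t) => y yx; apply: eq_fsbigr => n _.
have [/yx nt|nt] := ltnP (site n) (size t); first by rewrite /overwrite nt.
by rewrite /overwrite !nth_default// !subrr.
Qed.

Context (X : set Omega) (mX : measurable X).

(* Overwriting by t is injective only among the configurations that carry a
   given pattern on the overwritten sites; that pattern is u. *)
Definition patch_dom (g : GG) (tu : seq S * seq S) : set Omega :=
  [set x | [/\ X x, X (overwrite tu.1 x),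
    overwrite tu.2 (overwrite tu.1 x) = x & Psi x (overwrite tu.1 x) = g]].

Lemma measurable_patch_dom g tu : measurable (patch_dom g tu).
Proof.
rewrite (_ : patch_dom g tu = X `&` overwrite tu.1 @^-1` X `&`
    [set x | overwrite tu.2 (overwrite tu.1 x) = x] `&`
    [set x | Psi x (overwrite tu.1 x) = g]); last first.
  by apply/seteqP; split=> x /= => [[]|[[[]]]].
apply: measurableI; last exact: measurable_tms_Psi_overwrite.
apply: measurableI; last exact: measurable_overwriteK.
apply: measurableI => //; rewrite -[X in measurable X]setTI.
exact: measurable_overwrite.
Qed.

Lemma patch_image g t u :
  overwrite t @` patch_dom g (t, u) = patch_dom (- g) (u, t).
Proof.
have PsiN :=
  cocycle_sym (@tms_tail_trans X) (@tms_Psi_cocycle X) (@tms_tail_sym X).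
have patch_swap h t' u' x : patch_dom h (t', u') x ->
    patch_dom (- h) (u', t') (overwrite t' x).
  move=> [Xx Xtx tK <-]; split; rewrite /= ?tK//.
  by rewrite PsiN//; exact: tms_tail_overwrite.
apply/seteqP; split=> [_ [x /patch_swap ? <-]//|y yD].
exists (overwrite u y); last by have [] := yD.
by rewrite -[g]opprK; exact: patch_swap.
Qed.

Lemma patch_holonomy g tu :
  holonomy (tms_tail X) Psi g (patch_dom g tu) (overwrite tu.1).
Proof.
split=> [|x [Xx Xtx _ _]|x []//]; last exact: tms_tail_overwrite.
case: tu => t u.
apply: (@measurable_embedding_cancel _ _ _ _ _ _ (overwrite u)).
- exact: measurable_patch_dom.
- by rewrite patch_image; exact: measurable_patch_dom.
- exact: measurable_funTS (measurable_overwrite t).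
- exact: measurable_funTS (measurable_overwrite u).
- by move=> x; rewrite inE => -[].
Qed.

Lemma patch_cover x y : tms_tail X x y ->
  exists2 tu, patch_dom (Psi x y) tu x & overwrite tu.1 x = y.
Proof.
move=> xy; have [Xx [Xy _]] := xy; have [t tE] := exists_overwrite xy.
have [u uE] := exists_overwrite (tms_tail_sym xy).
by exists (t, u) => //; split; rewrite /= ?tE.
Qed.

Lemma tms_invariant_holonomy (R : realType) (p : probability Omega R) :
  tms_invariant p X (tms_tail_Psi X G) ->
  forall A f, holonomy (tms_tail X) Psi 0 A f -> p (f @` A) = p A.
Proof.
move=> [_ p_inv] A f [f_emb f_tail f_Psi]; have [mA _ _ _] := f_emb.
apply: (p_inv A (f @` A) f) => //; first exact/tms_borel_bijP.
- by move=> x /f_tail[].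
- by move=> _ [x /f_tail[_ [? _]] <-].
- by move=> x Ax; split; [exact: f_tail|exact: f_Psi].
Qed.

End Psi.
End configurations.

Theorem theorem1 (S : finType) (s0 : S) (d : nat) (X : set (cfgB d s0))
  (GG : countZmodType) (G : S -> GG) (R : realType)
  (p : probability (cfgB d s0) R) :
  (0 < d)%N ->
  tms_is_TMS X -> tms_irreducible X -> tms_top_transitive X (tms_tail X) ->
  p X = 1%E ->
  tms_global p X ->
  tms_nonsingular p X (tms_tail X) ->
  tms_invariant p X (tms_tail_Psi X G) ->
  tms_ergodic p X (tms_tail_Psi X G) ->
  exists H : GG -> R,
    (forall a b : GG, H (a + b) = H a + H b) /\
    tms_conformal p X (fun x y => H (tms_Psi G x y)).
Proof.
move=> _ /measurable_TMS mX _ _ pX _ p_nonsing p_inv p_erg.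
have kernel_ergodic A : measurable A -> A `<=` X ->
    (forall x y, A x -> tms_tail X x y -> tms_Psi G x y = 0 -> A y) ->
    p A = 0%E \/ p A = 1%E.
  by move=> mA AX A_closed; apply: p_erg => // x y Ax []; exact: A_closed.
have [H [H_add H_conf]] := ergodic_kernel_conformal (fun x y => @proj1 _ _)
  (@tms_tail_refl _ _ _ X) (@tms_tail_sym _ _ _ X) (@tms_tail_trans _ _ _ X)
  (@tms_Psi_cocycle _ _ _ _ G X) (patch_holonomy G mX)
  (@patch_cover _ _ _ _ G X) p_nonsing (tms_invariant_holonomy p_inv)
  kernel_ergodic mX pX (@countably_separated_cfgB d S s0).
exists H; split=> // B C f /tms_borel_bijP[f_emb _] _ _ f_tail A mA AB.
apply: H_conf => [|x /AB/f_tail//]; exact: sub_measurable_embedding AB.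
Qed.
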